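(* (1) For every infinite cardinal $\theta$ there are a countable vocabulary $\tau$ and $\tau$-models $M_n,N_n$ ($n<\omega$) such that for every $n$, $M_n$ and $N_n$ satisfy the same sentences of $\mathbb L^1_{\le\theta}(\tau)$, but $\prod_{n<\omega}M_n$ and $\prod_{n<\omega}N_n$ do not satisfy the same sentences of $\mathbb L^1_{\le2^{\aleph_0}}(\tau)$. (2) Moreover, for these models the player AIS has a winning strategy in the game $\Game_{\mathrm{qf}(\tau),2^{\aleph_0},\omega+1}\big[\prod_{n<\omega}M_n,\prod_{n<\omega}N_n\big]$.
   Context: The product $\prod_{n<\omega}M_n$ of $\tau$-models has universe the set of sequences $\langle a_n:n<\omega\rangle$ with $a_n\in M_n$; a predicate holds of a tuple of sequences iff it holds coordinatewise in every $M_n$; function symbols and constants are interpreted coordinatewise. The game $\Game_{\Gamma,\theta,\alpha}[M_1,M_2]$: states are tuples $(A^1,A^2,h^1,h^2,g,\beta,n)$ with $A^\ell\subseteq M_\ell$, $|A^\ell|\le\theta$, $\beta\le\alpha$, $n<\omega$, $h^\ell:A^\ell\to\omega$, $g$ a partial injection $M_1\to M_2$ with $g^1=g,g^2=g^{-1}$, $\mathrm{Dom}(g^\ell)\subseteq A^\ell$, $g$ preserving every formula of $\Gamma$, and $h^\ell(a)<n$ on $\mathrm{Dom}(g^\ell)$. Start: $(\emptyset,\emptyset,\emptyset,\emptyset,\emptyset,\alpha,0)$. At state $\mathbf s_n$, AIS picks $\iota\in\{1,2\}$, $\beta_{n+1}<\beta_n$, $A'$ with $A^\iota_n\subseteq A'\subseteq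 M_\iota$, $|A'|\le\theta$; ISO picks a state $\mathbf s_{n+1}$ with index $n+1$ and ordinal $\beta_{n+1}$ extending $\mathbf s_n$ coordinatewise, with $A^\iota_{n+1}=A'$, $A^{3-\iota}_{n+1}=A^{3-\iota}_n\cup\mathrm{Dom}(g^{3-\iota}_{n+1})$, $h^\iota_{n+1}(a)\ge n+1$ for new $a\in A'$, and $\mathrm{Dom}(g^\iota_{n+1})=\{a\in A^\iota_n:h^\iota_n(a)<n+1\}$. A player without legal move loses; for $\alpha=0$ ISO wins iff the start is a state. $\mathscr E^0$: ISO has a winning strategy; $\mathscr E^1$: equivalence relation generated by $\mathscr E^0$; $\mathrm{qf}(\tau)$: atomic formulas and negations. $\mathbb L^1_{\le\theta}$: a sentence of $\mathbb L^1_{\le\theta}(\tau)$ is given by $\tau_1\subseteq\tau$, $|\tau_1|\le\theta$, $\alpha<\theta^+$ and at most $\beth_{\alpha+1}(\theta)$ $\tau_1$-models $M_i$; $M\models\psi$ iff $M\restriction\tau_1\,\mathscr E^1_{\mathrm{qf}(\tau_1),\theta,\alpha}\,M_i$ for some $i$. *)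

(* Defs.v *)
From Stdlib Require Import Relations.Relation_Operators Wellfounded.
From mathcomp Require Import ssreflect ssrfun ssrbool eqtype ssrnat fintype.

Set Implicit Arguments.
Unset Strict Implicit.
Unset Printing Implicit Defensive.

Definition card_le (A B : Type) : Prop := exists f : A -> B, injective f.

Definition set_card_le (X : Type) (A : X -> Prop) (Theta : Type) : Prop :=
  card_le {x : X | A x} Theta.

(* (constants are 0-ary function symbols).                              *)
Record vocab := Vocab {
  Rsym : Type; Rar : Rsym -> nat;
  Fsym : Type; Far : Fsym -> nat }.

Definition countable_vocab (t : vocab) : Prop :=
  card_le (Rsym t) nat /\ card_le (Fsym t) nat.

Record model (t : vocab) := Model {
  carrier : Type;
  rel : forall r : Rsym t, ('I_(Rar r) -> carrier) -> Prop;
  fn  : forall f : Fsym t, ('I_(Far f) -> carrier) -> carrier }.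
Arguments carrier {t} m.
Arguments rel {t} m r _.
Arguments fn {t} m f _.

Definition prod_model (t : vocab) (Ms : nat -> model t) : model t :=
  @Model t (forall n, carrier (Ms n))
    (fun r xs => forall n, rel (Ms n) r (fun i => xs i n))
    (fun f xs => fun n => fn (Ms n) f (fun i => xs i n)).

Definition subvocab (t : vocab) (pR : Rsym t -> Prop) (pF : Fsym t -> Prop) : vocab :=
  @Vocab {r : Rsym t | pR r} (fun r => Rar (proj1_sig r))
         {f : Fsym t | pF f} (fun f => Far (proj1_sig f)).

Definition reduct (t : vocab) (pR : Rsym t -> Prop) (pF : Fsym t -> Prop)
  (M : model t) : model (subvocab pR pF) :=
  @Model (subvocab pR pF) (carrier M)
    (fun r xs => rel M (proj1_sig r) xs)
    (fun f xs => fn M (proj1_sig f) xs).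

Inductive term (t : vocab) (k : nat) : Type :=
| TVar : 'I_k -> term t k
| TFun : forall f : Fsym t, ('I_(Far f) -> term t k) -> term t k.

Fixpoint eval (t : vocab) (k : nat) (M : model t) (v : 'I_k -> carrier M)
  (u : term t k) : carrier M :=
  match u with
  | TVar i => v i
  | TFun f args => fn M f (fun i => @eval t k M v (args i))
  end.
Arguments eval {t k} M v u.

Inductive atomic (t : vocab) (k : nat) : Type :=
| ARel : forall r : Rsym t, ('I_(Rar r) -> term t k) -> atomic t k
| AEq : term t k -> term t k -> atomic t k.

Inductive qf_formula (t : vocab) (k : nat) : Type :=
| QPos : atomic t k -> qf_formula t k
| QNeg : atomic t k -> qf_formula t k.

Definition holds_atomic (t : vocab) (k : nat) (M : model t) (a : atomic t k)
  (v : 'I_k -> carrier M) : Prop :=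
  match a with
  | ARel r args => rel M r (fun i => eval M v (args i))
  | AEq u1 u2 => eval M v u1 = eval M v u2
  end.
Arguments holds_atomic {t k} M a v.

Definition holds_qf (t : vocab) (k : nat) (M : model t) (phi : qf_formula t k)
  (v : 'I_k -> carrier M) : Prop :=
  match phi with
  | QPos a => holds_atomic M a v
  | QNeg a => ~ holds_atomic M a v
  end.
Arguments holds_qf {t k} M phi v.

(* The ordinal alpha is given by a strict order wlt on W (its elements  *)
(* are the ordinals < alpha); ordinals <= alpha are option W, None=alpha*)
Section Game.
Variables (t : vocab) (Theta : Type) (W : Type) (wlt : W -> W -> Prop)
          (M1 M2 : model t).

Definition ltc (b1 b2 : option W) : Prop :=
  match b1, b2 with
  | Some x, Some y => wlt x y
  | Some _, None => True
  | _, _ => False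
  end.

(* (A^1, A^2, h^1, h^2, g, beta, n); g is given by its graph. *)
Record gstate := GState {
  A1 : carrier M1 -> Prop;
  A2 : carrier M2 -> Prop;
  h1 : carrier M1 -> nat;
  h2 : carrier M2 -> nat;
  gg : carrier M1 -> carrier M2 -> Prop;
  beta : option W;
  idx : nat }.

Definition preserves_qf (g : carrier M1 -> carrier M2 -> Prop) : Prop :=
  forall (k : nat) (phi : qf_formula t k) (v : 'I_k -> carrier M1)
         (w : 'I_k -> carrier M2),
    (forall i, g (v i) (w i)) -> holds_qf M1 phi v -> holds_qf M2 phi w.

Definition is_state (s : gstate) : Prop :=
  set_card_le (A1 s) Theta /\ set_card_le (A2 s) Theta /\
  (forall a b b', gg s a b -> gg s a b' -> b = b') /\
  (forall a a' b, gg s a b -> gg s a' b -> a = a') /\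
  (forall a b, gg s a b -> A1 s a /\ A2 s b) /\
  preserves_qf (gg s) /\
  (forall a b, gg s a b -> h1 s a < idx s /\ h2 s b < idx s).

Definition start : gstate :=
  @GState (fun _ => False) (fun _ => False) (fun _ => 0) (fun _ => 0)
          (fun _ _ => False) None 0.

Definition extends (s s' : gstate) : Prop :=
  (forall a, A1 s a -> A1 s' a) /\ (forall b, A2 s b -> A2 s' b) /\
  (forall a, A1 s a -> h1 s' a = h1 s a) /\
  (forall b, A2 s b -> h2 s' b = h2 s b) /\
  (forall a b, gg s a b -> gg s' a b).

Definition legal1 (s : gstate) (b' : option W) (A' : carrier M1 -> Prop) : Prop :=
  ltc b' (beta s) /\ (forall a, A1 s a -> A' a) /\ set_card_le A' Theta.
Definition legal2 (s : gstate) (b' : option W) (A' : carrier M2 -> Prop) : Prop :=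
  ltc b' (beta s) /\ (forall b, A2 s b -> A' b) /\ set_card_le A' Theta.

Definition resp1 (s : gstate) (b' : option W) (A' : carrier M1 -> Prop)
  (s' : gstate) : Prop :=
  is_state s' /\ idx s' = (idx s).+1 /\ beta s' = b' /\ extends s s' /\
  (forall a, A1 s' a <-> A' a) /\
  (forall b, A2 s' b <-> (A2 s b \/ exists a, gg s' a b)) /\
  (forall a, A' a -> ~ A1 s a -> (idx s).+1 <= h1 s' a) /\
  (forall a, (exists b, gg s' a b) <-> (A1 s a /\ h1 s a < (idx s).+1)).
Definition resp2 (s : gstate) (b' : option W) (A' : carrier M2 -> Prop)
  (s' : gstate) : Prop :=
  is_state s' /\ idx s' = (idx s).+1 /\ beta s' = b' /\ extends s s' /\
  (forall b, A2 s' b <-> A' b) /\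
  (forall a, A1 s' a <-> (A1 s a \/ exists b, gg s' a b)) /\
  (forall b, A' b -> ~ A2 s b -> (idx s).+1 <= h2 s' b) /\
  (forall b, (exists a, gg s' a b) <-> (A2 s b /\ h2 s b < (idx s).+1)).

(* ISO wins from s (a player without a legal move loses). *)
Inductive isowin : gstate -> Prop :=
| IsoWin : forall s,
    (forall b' A', legal1 s b' A' -> exists s', resp1 s b' A' s' /\ isowin s') ->
    (forall b' A', legal2 s b' A' -> exists s', resp2 s b' A' s' /\ isowin s') ->
    isowin s.

Inductive aiswin : gstate -> Prop :=
| AisWin1 : forall s b' A', legal1 s b' A' ->
    (forall s', resp1 s b' A' s' -> aiswin s') -> aiswin s
| AisWin2 : forall s b' A', legal2 s b' A' ->
    (forall s', resp2 s b' A' s' -> aiswin s') -> aiswin s.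

Definition E0 : Prop := is_state start /\ isowin start.

Definition AIS_wins : Prop := ~ is_state start \/ aiswin start.

End Game.

Record WO := MkWO {
  wo_W : Type;
  wo_lt : wo_W -> wo_W -> Prop;
  wo_wf : well_founded wo_lt;
  wo_trans : forall x y z, wo_lt x y -> wo_lt y z -> wo_lt x z;
  wo_total : forall x y, wo_lt x y \/ x = y \/ wo_lt y x }.

Definition E1 (t : vocab) (Theta : Type) (alpha : WO) : model t -> model t -> Prop :=
  clos_refl_sym_trans (model t)
    (fun M N => E0 Theta (@wo_lt alpha) M N).

(* Beth numbers: bethB x has cardinality beth_{rank x}(Theta);          *)
(* beth alpha Theta has cardinality beth_alpha(Theta).                  *)
Definition bethB (alpha : WO) (Theta : Type) : wo_W alpha -> Type :=
  Fix (@wo_wf alpha) (fun _ => Type)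
    (fun x rec => (Theta + {y : wo_W alpha & {H : wo_lt y x & (rec y H -> Prop)}})%type).

Definition beth (alpha : WO) (Theta : Type) : Type :=
  (Theta + {y : wo_W alpha & (bethB Theta y -> Prop)})%type.

Definition beth_succ (alpha : WO) (Theta : Type) : Type := beth alpha Theta -> Prop.

Record L1_sentence (Theta : Type) (t : vocab) := L1Sent {
  s_pR : Rsym t -> Prop;
  s_pF : Fsym t -> Prop;
  s_tau_card : card_le ({r : Rsym t | s_pR r} + {f : Fsym t | s_pF f}) Theta;
  s_alpha : WO;
  s_alpha_card : card_le (wo_W s_alpha) Theta;   (* alpha < Theta^+ *)
  s_I : Type;
  s_I_card : card_le s_I (beth_succ s_alpha Theta);
  s_models : s_I -> model (subvocab s_pR s_pF) }.
Arguments s_models {Theta t} l _.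

Definition sat1 (Theta : Type) (t : vocab) (M : model t) (psi : L1_sentence Theta t) : Prop :=
  exists i : s_I psi,
    E1 Theta (s_alpha psi) (reduct (s_pR psi) (s_pF psi) M) (s_models psi i).

Definition L1_equiv (Theta : Type) (t : vocab) (M N : model t) : Prop :=
  forall psi : L1_sentence Theta t, sat1 M psi <-> sat1 N psi.

(* The ordinal omega+1 = {0,1,...,omega}: option nat with None = omega. *)
Definition omega1_lt (x y : option nat) : Prop :=
  match x, y with
  | Some a, Some b => a < b
  | Some _, None => True
  | _, _ => False
  end.

Definition continuum : Type := nat -> bool.

(* Main.v *)
(** Both factors are trees whose nodes carry ranks that decrease along branches,
    every choice being repeated in many copies; the tree on the [M] side has in
    addition a rank above all others that may be repeated, hence an infinite
    branch, while the tree on the [N] side is well-founded of rank at least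
    [Theta^+].  In the [n]-th factor the relation [R_n] is the ancestor relation
    and the other relations are trivially true, so that in the products [R_n]
    compares [n]-th coordinates.

    In one factor ISO survives every game of length below [Theta^+]: she never
    reveals a node before its level has been reached, and keeps an isomorphism
    between the nodes of level at most [n] that identifies any two ranks above
    the current ordinal.

    In the product AIS plays the [omega^omega] many sequences of nodes of the
    infinite branches.  However ISO splits them into pieces [h = n], a diagonal
    argument gives an [n] for which the piece [h = n] meets every node of the
    branch in coordinate [n]; mapping this piece would yield an infinite
    descending sequence of ranks in the [n]-th coordinate on the well-founded
    side.  This property is invariant under [E0], because the images of the
    pieces can be partitioned again, so it also separates the [E1]-classes. *)

From Stdlib Require Import Relations.Relation_Operators.
From mathcomp Require Import seq choice.
From mathcomp Require Import boolp classical_sets functions cardinality.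
Require Import Defs.
From mathcomp Require Import ssreflect ssrfun ssrbool eqtype ssrnat fintype.

Set Implicit Arguments.
Unset Strict Implicit.
Unset Printing Implicit Defensive.

Local Open Scope classical_set_scope.

(** * Doubling an infinite cardinal *)

Lemma card_le_trans_type (A B C : Type) : card_le A B -> card_le B C -> card_le A C.
Proof. by move=> [f fi] [g gi]; exists (g \o f); apply: inj_comp. Qed.

Lemma infinite_set_seq (T : Type) (A : set T) : infinite_set A ->
  exists e : nat -> T, injective e /\ forall i, A (e i).
Proof.
move/infiniteP => /card_leP[f].
exists (fun i => set_val (f (SigSub (mem_set (I : [set: nat] i))))); split.
  move=> i j /val_inj /(@inj _ _ _ f) H.
  by have := H (mem_set I) (mem_set I) => /(congr1 val).
by move=> i; apply: set_mem; exact: valP.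
Qed.

(* Maximality leaves only a finite complement outside the domain of [G], and
   this remainder is absorbed by one copy of nat. *)
Lemma sum_card_le (T : Type) : card_le nat T -> card_le (T + T) T.
Proof.
move=> [e0 e0i].
(* [P] collects the graphs of partial injections from [T * nat] to [T] whose domain consists of
   whole columns and whose values again have their columns in the domain; so a member injects D *
   nat into D for some D. *)
pose P : set (set (T * nat * T)) := fun G =>
  [/\ forall p y z, G (p, y) -> G (p, z) -> y = z,
      forall p q y, G (p, y) -> G (q, y) -> p = q &
      forall x n y, G ((x, n), y) ->
        forall m, (exists z, G ((x, m), z)) /\ (exists z, G ((y, m), z))].
have [F PF Ftot|G [[Gf Gi Gd] Gmax]] := @Zorn_bigcup _ P.
  have two p q : (\bigcup_(X in F) X) p -> (\bigcup_(X in F) X) q ->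
      exists2 X, F X & X p /\ X q.
    move=> [X FX Xp] [Y FY Yq]; have [XY|YX] := Ftot _ _ FX FY.
      by exists Y => //; split=> //; apply: XY.
    by exists X => //; split=> //; apply: YX.
  split.
  - by move=> p y z py pz; have [X /PF[Xf _ _] [? ?]] := two _ _ py pz; apply: (Xf p).
  - by move=> p q y py qy; have [X /PF[_ Xi _] [? ?]] := two _ _ py qy; apply: (Xi _ _ y).
  - move=> x n y [X FX Xp] m; have [_ _ Xd] := PF _ FX.
    by have [[z ?] [z' ?]] := Xd _ _ _ Xp m; split; [exists z|exists z']; exists X.
pose D : set T := fun x => exists y, G ((x, 0), y).
have DG x n : D x -> exists y, G ((x, n), y) by move=> [y /Gd /(_ n)[]].
have GD x n y : G ((x, n), y) -> D x /\ D y by move/Gd => /(_ 0)[].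
have finD : finite_set (~` D).
  apply: contrapT => /infinite_set_seq[e [ei eD]].
  (* If infinitely many elements lay outside [D], pairing on a sequence of them would properly
     extend [G]. *)
  pose H : set (T * nat * T) := fun p => exists i j, p = ((e i, j), e (pickle (i, j))).
  have HG p y q z : H (p, y) -> G (q, z) -> (p <> q) /\ (y <> z).
    move=> [i [j [-> ->]]]; case: q => x n /GD[Dx Dz].
    split; [by case=> xe _; apply: (eD i); rewrite xe|move=> ez].
    by apply: (eD (pickle (i, j))); rewrite ez.
  apply: (Gmax (G `|` H)).
    split; first by move=> p Gp; left.
    move=> /(_ ((e 0, 0), e (pickle (0, 0)))) /(_ (or_intror _)) GH.
    have /GD[De _] : G ((e 0, 0), e (pickle (0, 0))) by apply: GH; exists 0, 0.
    exact: eD De.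
  split.
  - move=> p y z [Gy|Hy] [Gz|Hz].
    + exact: Gf Gy Gz.
    + by have [] := HG _ _ _ _ Hz Gy.
    + by have [] := HG _ _ _ _ Hy Gz.
    + move: Hy Hz => [i [j [-> ->]]] [i' [j' [/ei -> -> ->]]] //.
  - move=> p q y [Gy|Hy] [Gz|Hz].
    + exact: Gi Gy Gz.
    + by have [] := HG _ _ _ _ Hz Gy.
    + by have [] := HG _ _ _ _ Hy Gz.
    + move: Hy Hz => [i [j [-> ->]]] [i' [j' [-> /ei]]].
      by move/(pcan_inj (@pickleK _)) => [-> ->].
  - move=> x n y [/Gd H0|[i [j [-> _ ->]]]] m.
      by have [[z ?] [z' ?]] := H0 m; split; [exists z|exists z']; left.
    by split; [exists (e (pickle (i, m)))|exists (e (pickle (pickle (i, j), m)))];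
       right; [exists i, m|exists (pickle (i, j)), m].
have [d0 Dd0] : exists d, D d.
  apply: contrapT => nD.
  have DT : (~` D) = [set: T].
    by apply/seteqP; split=> // x _ Dx; apply: nD; exists x.
  suff : infinite_set [set: T] by apply; rewrite -DT.
  apply/infiniteP; have /card_ge_preimage : {in e0 @^-1` setT &, injective e0}.
    by move=> i j _ _ /e0i.
  by rewrite preimage_setT.
have /pcard_injP[r ri] := finite_set_countable finD.
(* Elements of [D] use entries 0 and 1 of their own column. The finitely many others, numbered by
   [r], share the column of [d0] from entry 2 on, even and odd offsets separating the two
   summands. *)
pose src x b := if pselect (D x) then (x, b) else (d0, ((r x).*2 + b).+2).
have srcG (p : T + T) : exists y,
    G (match p with inl x => src x 0 | inr x => src x 1 end, y).
  by case: p => x; rewrite /src; case: pselect => Dx; apply: DG.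
have [f fG] := choice srcG; exists f => p q fpq.
have /Gi : G (match q with inl x => src x 0 | inr x => src x 1 end, f p).
  by rewrite fpq.
move=> /(_ _ (fG p)).
have NDi x y : ~ D x -> ~ D y -> r x = r y -> x = y.
  by move=> Dx Dy; apply: ri; apply: mem_set.
have odd_neq m n : m.*2 + 0 <> n.*2 + 1.
  by move/(congr1 odd); rewrite !oddD !odd_double.
case: p {fpq} => x; case: q => y; rewrite /src; do 2 case: pselect => ?; case=> //.
- by move=> ->.
- by rewrite !addn0 => /double_inj/NDi ->.
- by move=> E; case: (odd_neq _ _ (esym E)).
- by move=> E; case: (odd_neq _ _ E).
- by move=> ->.
- by rewrite !addn1 => -[/double_inj/NDi ->].
Qed.

(** * AIS and robust chains *)

(** Carries arguments about moves in one model over to moves in the other. *)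
Definition swap (t : vocab) (W : Type) (M1 M2 : model t) (s : gstate W M1 M2) :
    gstate W M2 M1 :=
  GState (A2 s) (A1 s) (h2 s) (h1 s) (fun b a => gg s a b) (beta s) (idx s).

Lemma swapK (t : vocab) (W : Type) (M1 M2 : model t) (s : gstate W M1 M2) :
  swap (swap s) = s.
Proof. by case: s. Qed.

Lemma preserves_qf_sym (t : vocab) (M1 M2 : model t)
    (g : carrier M1 -> carrier M2 -> Prop) :
  preserves_qf g -> preserves_qf (fun b a => g a b).
Proof.
move=> gP k [a|a] v w gwv /= Ha; last by move=> /(gP _ (QPos a) _ _ gwv).
by apply: contrapT => /(gP _ (QNeg a) _ _ gwv).
Qed.

Lemma is_state_swap (t : vocab) (Theta W : Type) (M1 M2 : model t)
    (s : gstate W M1 M2) :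
  is_state Theta s -> is_state Theta (swap s).
Proof.
move=> [? [? [gf [gi [gA [gP gh]]]]]].
refine (conj _ (conj _ (conj _ (conj _ (conj _ (conj _ _)))))) => //=.
- by move=> b a a'; apply: gi.
- by move=> b b' a; apply: gf.
- by move=> b a /gA[].
- exact: preserves_qf_sym.
- by move=> b a /gh[].
Qed.

Lemma extends_swap (t : vocab) (W : Type) (M1 M2 : model t)
    (s s' : gstate W M1 M2) :
  extends s s' -> extends (swap s) (swap s').
Proof. by move=> [? [? [? [? gs]]]]; rewrite /extends /=; intuition. Qed.

Lemma resp1_swap (t : vocab) (Theta W : Type) (M1 M2 : model t)
    (s s' : gstate W M1 M2) b' A' :
  resp1 Theta s b' A' s' -> resp2 Theta (swap s) b' A' (swap s').
Proof.
move=> [/is_state_swap ? [? [? [/extends_swap ? [? [? [? ?]]]]]]].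
by rewrite /resp1 /resp2 /=; intuition.
Qed.

Lemma resp2_swap (t : vocab) (Theta W : Type) (M1 M2 : model t)
    (s s' : gstate W M1 M2) b' A' :
  resp2 Theta s b' A' s' -> resp1 Theta (swap s) b' A' (swap s').
Proof.
move=> [/is_state_swap ? [? [? [/extends_swap ? [? [? [? ?]]]]]]].
by rewrite /resp1 /resp2 /=; intuition.
Qed.

(** The recursive occurrence in [isowin] sits under [exists] and a conjunction; the fixpoint unpacks
    both to obtain the induction hypotheses. *)
Lemma isowin_elim (t : vocab) (Theta W : Type) (wlt : W -> W -> Prop)
    (M1 M2 : model t) (P : gstate W M1 M2 -> Prop) :
  (forall s,
    (forall b' A', legal1 Theta wlt s b' A' -> exists2 s', resp1 Theta s b' A' s' & P s') ->
    (forall b' A', legal2 Theta wlt s b' A' -> exists2 s', resp2 Theta s b' A' s' & P s') ->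
    P s) ->
  forall s, isowin Theta wlt s -> P s.
Proof.
move=> Pstep.
exact: (fix IH s (w : isowin Theta wlt s) : P s :=
  match w in isowin _ _ s return P s with
  | IsoWin s i1 i2 => Pstep s
      (fun b A l => match i1 b A l with
        ex_intro s' (conj r w') => ex_intro2 _ _ s' r (IH s' w') end)
      (fun b A l => match i2 b A l with
        ex_intro s' (conj r w') => ex_intro2 _ _ s' r (IH s' w') end)
  end).
Qed.

Lemma isowin_swap (t : vocab) (Theta W : Type) (wlt : W -> W -> Prop)
    (M1 M2 : model t) (s : gstate W M1 M2) :
  isowin Theta wlt s -> isowin Theta wlt (swap s).
Proof.
move: s; apply: isowin_elim => s iso1 iso2; apply: IsoWin => b' A' leg.
  by have [s' /resp2_swap rs' ws'] := iso2 b' A' leg; exists (swap s').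
by have [s' /resp1_swap rs' ws'] := iso1 b' A' leg; exists (swap s').
Qed.

Lemma E0_sym (t : vocab) (Theta W : Type) (wlt : W -> W -> Prop) (M N : model t) :
  E0 Theta wlt M N -> E0 Theta wlt N M.
Proof. by move=> [/is_state_swap ? /isowin_swap ?]. Qed.

Lemma isowin_not_aiswin (t : vocab) (Theta W : Type) (wlt : W -> W -> Prop)
    (M1 M2 : model t) (s : gstate W M1 M2) :
  isowin Theta wlt s -> ~ aiswin Theta wlt s.
Proof.
move=> + win; elim: win => {}s b' A' leg _ IH iso; case: iso leg IH => {}s iso1 iso2 leg IH.
  by have [s' [/IH H /H]] := iso1 _ _ leg.
by have [s' [/IH H /H]] := iso2 _ _ leg.
Qed.

(** Defined for every arity, so that chains make sense in an arbitrary vocabulary. *)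
Definition bin (t : vocab) (M : model t) (r : Rsym t) (x y : carrier M) : Prop :=
  Defs.rel M r (fun i => if i == 0 :> nat then x else y).
Arguments bin {t} M r x y.

(* Quantifying over [h] anticipates the delays, by which ISO splits every set
   played by AIS into countably many pieces. *)
Definition robust_chain (Theta : Type) (t : vocab) (M : model t) : Prop :=
  exists A : carrier M -> Prop, set_card_le A Theta /\
    forall h : carrier M -> nat, exists (r : Rsym t) (m : nat) (x : nat -> carrier M),
      (forall i, A (x i) /\ h (x i) = m) /\
      forall i j, i < j -> bin M r (x i) (x j).

Lemma preserves_qf_bin (t : vocab) (M1 M2 : model t)
    (g : carrier M1 -> carrier M2 -> Prop) r x y x' y' :
  preserves_qf g -> g x x' -> g y y' -> bin M1 r x y -> bin M2 r x' y'.
Proof.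
move=> gP gx gy.
pose args := fun i : 'I_(Rar r) =>
  TVar t (if i == 0 :> nat then ord0 else ord_max : 'I_2).
have := gP 2 (QPos (ARel args))
  (fun j => if j == ord0 then x else y) (fun j => if j == ord0 then x' else y').
rewrite /bin /=; have E T (u v : T) :
    (fun i : 'I_(Rar r) => if (if i == 0 :> nat then ord0 else ord_max : 'I_2) == ord0
       then u else v) = (fun i => if i == 0 :> nat then u else v).
  by apply: functional_extensionality_dep => i; case: (nat_of_ord i == 0).
by rewrite !E => H; apply: H => j; case: ifP.
Qed.

(** AIS may move idly: he offers no new element and only spends an ordinal, while the index
    advances. *)
Lemma forced_step (t : vocab) (Theta W : Type) (wlt : W -> W -> Prop)
    (M N : model t) (b : option W) (s : gstate W M N) :
  ltc wlt b (beta s) -> set_card_le (A1 s) Theta -> ~ aiswin Theta wlt s ->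
  exists s', resp1 Theta s b (A1 s) s' /\ ~ aiswin Theta wlt s'.
Proof.
move=> bs cA nwin; apply: contrapT => H; apply: nwin.
have leg : legal1 Theta wlt s b (A1 s) by [].
apply: (AisWin1 leg) => s' rs.
by apply: contrapT => nwin; apply: H; exists s'.
Qed.

Lemma set_card_le_sub (X : Type) (A B : X -> Prop) (Theta : Type) :
  (forall x, B x -> A x) -> set_card_le A Theta -> set_card_le B Theta.
Proof.
move=> BA [f fi]; exists (fun b => f (exist _ (sval b) (BA _ (proj2_sig b)))).
by move=> [b Bb] [c Bc] /fi [bc]; apply: eq_exist.
Qed.

(** The ordinals k, ..., 0 pay for k + 1 idle moves; after them every delay below [idx s + k.+1] has
    expired, so ISO must have mapped these elements. *)
Lemma forced_embedding (t : vocab) (Theta : Type) (M N : model t) (k : nat)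
    (s : gstate (option nat) M N) :
  ltc omega1_lt (Some (Some k)) (beta s) -> set_card_le (A1 s) Theta ->
  ~ aiswin Theta omega1_lt s ->
  exists g : carrier M -> carrier N -> Prop,
    [/\ forall a b b', g a b -> g a b' -> b = b',
        preserves_qf g &
        forall a, A1 s a -> h1 s a < idx s + k.+1 -> exists b, g a b].
Proof.
elim: k s => [|k IH] s bs cA nwin;
  have [s' [rs nwin']] := forced_step bs cA nwin;
  have [[_ [cA2 [gf [gi [gA [gP gh]]]]]] [id' [be' [ext [A1' [_ [_ dom]]]]]]] := rs;
  have [_ [_ [h1e _]]] := ext.
  exists (gg s'); split=> // a Aa ha; apply/dom; split=> //.
  by rewrite addn1 in ha.
have [| |//|g [gf' gP' gd]] := IH s'.
- by rewrite be' /=.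
- by apply: set_card_le_sub cA => a /A1'.
- exists g; split=> // a Aa ha; apply: gd; first exact/A1'.
  by rewrite h1e // id' addSnnS.
Qed.

(* AIS plays the witness [A]; a surviving ISO would have to embed each piece of
   the partition [h], which makes the union of the images a witness for [N]. *)
Lemma robust_chain_aiswin (Theta : Type) (t : vocab) (M N : model t) :
  robust_chain Theta M -> ~ robust_chain Theta N ->
  aiswin Theta omega1_lt (start _ M N).
Proof.
move=> [A [cA robA]] nN.
(* [Some None] is the ordinal omega: after this move AIS can still choose any finite number of idle
   moves. *)
have leg : legal1 Theta omega1_lt (start (option nat) M N) (Some None) A by [].
apply: (AisWin1 leg) => s [_ [id1 [be1 [_ [A1s _]]]]].
apply: contrapT => nwin; apply: nN.
have cAs : set_card_le (A1 s) Theta by apply: set_card_le_sub cA => a /A1s.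
have emb k : exists g : carrier M -> carrier N -> Prop,
    [/\ forall a b b', g a b -> g a b' -> b = b',
        preserves_qf g & forall a, A a -> h1 s a <= k -> exists b, g a b].
  have [|//|//|g [gf gP gd]] := @forced_embedding _ Theta _ _ k s.
    by rewrite be1.
  exists g; split=> // a /A1s Aa ha; apply: gd => //.
  by rewrite ltn_addl // ltnS.
have {emb} [g gE] := choice emb.
(* The maps [g k] stem from different continuations and need not agree, so each is used only on the
   piece of delay k. [G] is a function, possibly not injective. *)
pose G a b := A a /\ g (h1 s a) a b.
have Gf a b b' : G a b -> G a b' -> b = b'.
  by move=> [_ gab] [_ gab']; have [gf _ _] := gE (h1 s a); apply: gf gab gab'.
have Gd a : A a -> exists b, G a b.
  by move=> Aa; have [_ _ /(_ a Aa (leqnn _)) [b ?]] := gE (h1 s a); exists b.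
exists (fun b => exists a, G a b); split.
  have [f fi] := cA.
  have [c cG] : {c : {b | exists a, G a b} -> {a | A a} &
      forall b, G (sval (c b)) (sval b)}.
    apply: (@choice _ _ (fun b a => G (sval a) (sval b))) => -[b [a Gab]].
    by exists (exist _ a (proj1 Gab)).
  exists (f \o c) => b b' /fi cb; have := cG b'; rewrite -cb => Gb'.
  have := Gf _ _ _ (cG b) Gb'; case: b b' {cb Gb'} => [b Bb] [b' Bb'] /= bb'.
  exact: eq_exist.
move=> h'.
(* Coding the delay together with the colour of the image keeps a chain of one [h'']-colour inside
   one piece, where a single [g k] preserves the relation. *)
have [h'' h''E] : {h'' : carrier M -> nat & forall a b, G a b ->
    h'' a = pickle (h1 s a, h' b)}.
  apply: (@choice _ _ (fun a n => forall b, G a b -> n = pickle (h1 s a, h' b))) => a.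
  have [[b Gab]|nG] := pselect (exists b, G a b).
    by exists (pickle (h1 s a, h' b)) => b' /(Gf _ _ _ Gab) <-.
  by exists 0 => b Gab; case: nG; exists b.
have [r [m [x [xA xr]]]] := robA h''.
have [y yG] := choice (fun i => Gd _ (proj1 (xA i))).
have pm i j : h1 s (x i) = h1 s (x j) /\ h' (y i) = h' (y j).
  have : pickle (h1 s (x i), h' (y i)) = pickle (h1 s (x j), h' (y j)).
    by rewrite -!(h''E _ _ (yG _)) (proj2 (xA i)) (proj2 (xA j)).
  by move/(pcan_inj (@pickleK _)) => [-> ->].
exists r, (h' (y 0)), y; split=> [i|i j ij].
  by split; [exists (x i)|have [_] := pm i 0].
have [_ gP _] := gE (h1 s (x i)).
apply: (preserves_qf_bin gP) (xr _ _ ij); first by have [] := yG i.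
by have [_] := yG j; have [<-] := pm i j.
Qed.

Lemma robust_chain_E0 (Theta : Type) (t : vocab) (M N : model t) :
  E0 Theta omega1_lt M N -> robust_chain Theta M -> robust_chain Theta N.
Proof.
move=> [_ /isowin_not_aiswin iso] QM; apply: contrapT => QN.
exact/iso/robust_chain_aiswin.
Qed.

Lemma omega1_lt_wf : well_founded omega1_lt.
Proof.
have fin n : Acc omega1_lt (Some n).
  have [k] := ubnP n; elim: k n => [n|k IH n nk]; first by move=> nk; exfalso.
  apply: Acc_intro => -[m mn|[]]; apply: IH.
  exact: leq_trans mn nk.
by case=> [n|]; [exact: fin|apply: Acc_intro => -[n _|[]]; exact: fin].
Qed.

Lemma omega1_lt_trans x y z : omega1_lt x y -> omega1_lt y z -> omega1_lt x z.
Proof. by case: x y z => [x|] [y|] [z|] //=; apply: ltn_trans. Qed.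

Lemma omega1_lt_total x y : omega1_lt x y \/ x = y \/ omega1_lt y x.
Proof.
case: x y => [x|] [y|] /=; auto.
by case: (ltngtP x y) => [||->]; auto.
Qed.

Definition omega1 : WO := MkWO omega1_lt_wf omega1_lt_trans omega1_lt_total.

Lemma robust_chain_E1 (Theta : Type) (t : vocab) (M N : model t) :
  E1 Theta omega1 M N -> robust_chain Theta M <-> robust_chain Theta N.
Proof.
elim=> {M N} [M N MN|//|M N _ ->//|M N P _ -> _ ->//].
split; first exact: robust_chain_E0 MN.
exact: robust_chain_E0 (E0_sym MN).
Qed.

(** * ISO and levels *)

Record level_iso (t : vocab) (M1 M2 : model t) (lev1 : carrier M1 -> nat)
    (lev2 : carrier M2 -> nat) (n : nat) (F : carrier M1 -> carrier M2 -> Prop) :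
    Prop := LevelIso {
  li_fun : forall a b b', F a b -> F a b' -> b = b';
  li_inj : forall a a' b, F a b -> F a' b -> a = a';
  li_dom : forall a, lev1 a <= n -> exists b, F a b;
  li_img : forall b, lev2 b <= n -> exists a, F a b;
  li_lev : forall a b, F a b -> lev1 a = lev2 b;
  li_qf : preserves_qf F }.

Lemma level_iso_sym (t : vocab) (M1 M2 : model t) lev1 lev2 n
    (F : carrier M1 -> carrier M2 -> Prop) :
  level_iso lev1 lev2 n F -> level_iso lev2 lev1 n (fun b a => F a b).
Proof.
move=> [Ff Fi Fd Fr Fl Fq]; split=> //.
- by move=> b a a'; apply: Fi.
- by move=> b b' a; apply: Ff.
- by move=> b a /Fl.
- exact: preserves_qf_sym.
Qed.

(* An element can only be revealed once its level has been reached, and the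
   delays never postpone it beyond that. *)
Definition level_inv (t : vocab) (Theta W : Type) (M1 M2 : model t)
    (lev1 : carrier M1 -> nat) (lev2 : carrier M2 -> nat)
    (s : gstate W M1 M2) (F : carrier M1 -> carrier M2 -> Prop) : Prop :=
  [/\ is_state Theta s,
      forall a b, gg s a b -> F a b,
      forall a m, A1 s a -> idx s < m -> (h1 s a < m) = (lev1 a < m) &
      forall b m, A2 s b -> idx s < m -> (h2 s b < m) = (lev2 b < m)].

Lemma level_inv_swap (t : vocab) (Theta W : Type) (M1 M2 : model t) lev1 lev2
    (s : gstate W M1 M2) F :
  level_inv Theta lev1 lev2 s F ->
  level_inv Theta lev2 lev1 (swap s) (fun b a => F a b).
Proof. by move=> [/is_state_swap ? gF ? ?]; split=> // b a /gF. Qed.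

(** ISO plays [F'] on the elements whose delay has expired; by the invariant their levels are below
    the new index, so [F'] is defined there. Doubling [Theta] absorbs the images added on the other
    side. *)
Lemma level_resp1 (t : vocab) (Theta W : Type) (wlt : W -> W -> Prop)
    (M1 M2 : model t) lev1 lev2 (s : gstate W M1 M2)
    (F F' : carrier M1 -> carrier M2 -> Prop) b' A' :
  card_le (Theta + Theta) Theta ->
  level_inv Theta lev1 lev2 s F -> (forall a b, F a b -> F' a b) ->
  level_iso lev1 lev2 (idx s).+1 F' -> legal1 Theta wlt s b' A' ->
  exists s', resp1 Theta s b' A' s' /\ level_inv Theta lev1 lev2 s' F'.
Proof.
move=> cTT [[c1 [c2 [gf [gi [gA [gP gh]]]]]] gF inv1 inv2] FF'.
move=> [F'f F'i F'd F'r F'l F'q] [b's [AA' cA']].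
pose n := idx s.
pose g' a b := [/\ F' a b, A1 s a & h1 s a < n.+1].
pose B' b := A2 s b \/ exists a, g' a b.
(* A new element gets its level as delay, raised to n + 1 as the rules demand. A new image gets
   exactly its level, which is below n + 1 because [F'] preserves levels. *)
pose k1 a := if pselect (A1 s a) then h1 s a else maxn n.+1 (lev1 a).
pose k2 b := if pselect (A2 s b) then h2 s b else lev2 b.
have k1A a : A1 s a -> k1 a = h1 s a by rewrite /k1; case: pselect.
have k2A b : A2 s b -> k2 b = h2 s b by rewrite /k2; case: pselect.
have g'lev a b : g' a b -> lev2 b < n.+1.
  by move=> [/F'l <- Aa]; rewrite inv1.
have gg' a b : gg s a b -> g' a b.
  move=> gab; split; first exact/FF'/gF.
    by have [] := gA _ _ gab.
  by have [+ _] := gh _ _ gab => /ltnW.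
have st : is_state Theta (GState A' B' k1 k2 g' b' n.+1).
  refine (conj cA' (conj _ (conj _ (conj _ (conj _ (conj _ _)))))) => /=.
  - have [f fi] := cTT; have [f1 f1i] := c1; have [f2 f2i] := c2.
    have [c cE] : {c : {b | B' b} -> Theta + Theta & forall b,
        (exists Ab, c b = inl (f2 (exist _ (sval b) Ab))) \/
        (exists a Aa, c b = inr (f1 (exist _ a Aa)) /\ g' a (sval b))}.
      apply: (@choice _ _ (fun b x => (exists Ab, x = inl (f2 (exist _ (sval b) Ab))) \/
        (exists a Aa, x = inr (f1 (exist _ a Aa)) /\ g' a (sval b)))).
      move=> [b [Ab|[a gab]]]; first by exists (inl (f2 (exist _ b Ab))); left; exists Ab.
      have [_ Aa _] := gab.
      by exists (inr (f1 (exist _ a Aa))); right; exists a, Aa.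
    have sval_eq (b d : {b | B' b}) : sval b = sval d -> b = d.
      by case: b d => [b Bb] [d Bd] /= bd; apply: eq_exist.
    exists (f \o c) => b d /fi; case: (cE b) => [[Ab ->]|[a [Aa [-> [Fab _ _]]]]];
      case: (cE d) => [[Ad ->]|[a' [Aa' [-> [Fad _ _]]]]] //.
      by case=> /f2i[] /sval_eq.
    case=> /f1i[] aa'; rewrite -aa' in Fad.
    exact/sval_eq/(F'f _ _ _ Fab Fad).
  - by move=> a b d [Fab _ _] [Fad _ _]; apply: F'f Fab Fad.
  - by move=> a a' b [Fab _ _] [Fad _ _]; apply: F'i Fab Fad.
  - by move=> a b gab; split; [have [_ /AA'] := gab|right; exists a].
  - by move=> k phi v w gvw; apply: F'q => i; have [] := gvw i.
  - move=> a b gab; have /g'lev lb := gab; have [Fab Aa ha] := gab.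
    split; first by rewrite k1A.
    rewrite /k2; case: pselect => // Ab.
    by rewrite inv2.
exists (GState A' B' k1 k2 g' b' n.+1); split; last first.
  split=> //=; first by move=> a b [].
    move=> a m Aa nm; rewrite /k1; case: pselect => As.
      by rewrite inv1 // ltnW.
    by rewrite gtn_max nm.
  move=> b m Bb nm; rewrite /k2; case: pselect => As //.
  by rewrite inv2 // ltnW.
refine (conj st (conj erefl (conj erefl (conj _ (conj _ (conj _ (conj _ _))))))) => //=.
- refine (conj _ (conj _ (conj _ (conj _ _)))) => //= b Ab.
  by left.
- move=> a A'a nAa; rewrite /k1; case: pselect => [/nAa []|_] /=.
  by rewrite leq_maxl.
- move=> a; split=> [[b []] //|[Aa ha]].
  have [|b Fab] := F'd a; last by exists b.
  by rewrite ltnW // -/n -inv1.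
Qed.

Lemma ltc_wf (W : Type) (wlt : W -> W -> Prop) :
  well_founded wlt -> well_founded (ltc wlt).
Proof.
move=> wf; have wfS w : Acc (ltc wlt) (Some w).
  by elim: (wf w) => {}w _ IH; apply: Acc_intro => -[v /IH|[]].
by case=> [w|]; [exact: wfS|apply: Acc_intro => -[v _|[]]; exact: wfS].
Qed.

(** A back-and-forth criterion: [Fam b n] holds the maps ISO may keep at index n with ordinal b
    left. Each move lowers b and asks for one more level; induction on b. *)
Lemma level_E0 (t : vocab) (Theta W : Type) (wlt : W -> W -> Prop)
    (M1 M2 : model t) (lev1 : carrier M1 -> nat) (lev2 : carrier M2 -> nat)
    (Fam : option W -> nat -> (carrier M1 -> carrier M2 -> Prop) -> Prop) :
  card_le (Theta + Theta) Theta -> well_founded wlt ->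
  (forall b n F, Fam b n F -> level_iso lev1 lev2 n F) ->
  (forall b n F b', Fam b n F -> ltc wlt b' b ->
    exists2 F', Fam b' n.+1 F' & forall x y, F x y -> F' x y) ->
  (exists F, Fam None 0 F) ->
  E0 Theta wlt M1 M2.
Proof.
move=> cTT wf Fiso Fstep [F0 Fam0].
have start_state : is_state Theta (start W M1 M2).
  have c0 T : set_card_le (fun _ : T => False) Theta.
    by exists (fun x => False_rect _ (proj2_sig x)) => -[].
  refine (conj _ (conj _ (conj _ (conj _ (conj _ (conj _ _)))))) => //=.
  move=> k phi v w gvw; apply: (li_qf (Fiso _ _ _ Fam0)) => i.
  by case: (gvw i).
split=> //.
suff win b s F : beta s = b -> Fam b (idx s) F -> level_inv Theta lev1 lev2 s F ->
    isowin Theta wlt s.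
  by apply: (win None (start W M1 M2) F0 erefl Fam0); split.
elim: (ltc_wf wf b) s F => {}b _ IH s F sb FamF inv.
constructor=> b' A' leg; have [+ _] := leg; rewrite sb => b'b;
  have [F' FamF' FF'] := Fstep _ _ _ _ FamF b'b; have isoF' := Fiso _ _ _ FamF'.
  have [s' [rs inv']] := level_resp1 cTT inv FF' isoF' leg.
  exists s'; split=> //; have [_ [is' [bs' _]]] := rs.
  by apply: (IH _ b'b _ F') => //; rewrite is'.
have [s' [/resp1_swap rs inv']] := level_resp1 (s := swap s) cTT
  (level_inv_swap inv) (fun b a => FF' a b) (level_iso_sym isoF') leg.
exists (swap s'); rewrite swapK in rs; split=> //; have [_ [is' [bs' _]]] := rs.
apply: (IH _ b'b _ F') => //; first by rewrite is'.
exact: level_inv_swap inv'.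
Qed.

(** * Ranks and trees *)

(** For well-founded [below] this compares ordinal ranks, expressed as a simulation so that no
    ordinals have to be constructed. *)
Inductive rank_le (D : Type) (below : D -> D -> Prop) (a b : D) : Prop :=
  RankLe : (forall a', below a' a -> exists2 b', below b' b & rank_le below a' b') ->
    rank_le below a b.

Definition rank_lt (D : Type) (below : D -> D -> Prop) (a b : D) : Prop :=
  exists2 b', below b' b & rank_le below a b'.

Lemma rank_le_total (D : Type) (below : D -> D -> Prop) (a b : D) :
  well_founded below -> rank_le below a b \/ rank_lt below b a.
Proof.
move=> wf; elim: (wf a) b => {}a _ IH b.
have [ba|nba] := pselect (rank_lt below b a); [by right|left].
split=> a' a'a; apply: contrapT => nex; apply: nba; exists a' => //.
split=> b' b'b; have [a'b'|//] := IH _ a'a b'.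
by case: nex; exists b'.
Qed.

Lemma rank_le_refl (D : Type) (below : D -> D -> Prop) (a : D) :
  well_founded below -> rank_le below a a.
Proof.
by move=> wf; elim: (wf a) => {}a _ IH; split=> a' a'a; exists a' => //; apply: IH.
Qed.

Lemma rank_le_trans (D : Type) (below : D -> D -> Prop) (a b c : D) :
  well_founded below ->
  rank_le below a b -> rank_le below b c -> rank_le below a c.
Proof.
move=> wf; elim: (wf a) b c => {}a _ IH b c [ab] [bc]; split=> a' a'a.
have [b' b'b a'b'] := ab _ a'a; have [c' c'c b'c'] := bc _ b'b.
by exists c' => //; apply: IH a'a _ _ a'b' b'c'.
Qed.

Lemma below_rank_le (D : Type) (below : D -> D -> Prop) (a b : D) :
  well_founded below -> below a b -> rank_le below a b.
Proof.
move=> wf; elim: (wf a) b => {}a _ IH b ab; split=> a' a'a.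
by exists a => //; apply: IH.
Qed.

Lemma rank_lt_le_trans (D : Type) (below : D -> D -> Prop) (a b c : D) :
  well_founded below ->
  rank_lt below a b -> rank_le below b c -> rank_lt below a c.
Proof.
move=> wf [b' b'b ab'] [bc]; have [c' c'c b'c'] := bc _ b'b.
by exists c' => //; apply: rank_le_trans ab' b'c'.
Qed.

Lemma rank_le_lt_trans (D : Type) (below : D -> D -> Prop) (a b c : D) :
  well_founded below ->
  rank_le below a b -> rank_lt below b c -> rank_lt below a c.
Proof. by move=> wf ab [c' c'c bc']; exists c' => //; apply: rank_le_trans ab bc'. Qed.

Lemma rank_ltW (D : Type) (below : D -> D -> Prop) (a b : D) :
  well_founded below -> rank_lt below a b -> rank_le below a b.
Proof.
by move=> wf [b' /(below_rank_le wf) b'b ab']; apply: rank_le_trans ab' b'b.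
Qed.

Lemma rank_lt_wf (D : Type) (below : D -> D -> Prop) :
  well_founded below -> well_founded (rank_lt below).
Proof.
(* Treating all points of rank at most that of [a] at once lets the induction run along [below]. *)
move=> wf a; suff : forall b, rank_le below b a -> Acc (rank_lt below) b.
  by apply; apply: rank_le_refl.
elim: (wf a) => {}a _ IH b [ba]; apply: Acc_intro => c [b' b'b cb'].
have [a' a'a b'a'] := ba _ b'b.
by apply: IH a'a _ _; apply: rank_le_trans cb' b'a'.
Qed.

(* A node is the list of the choices leading to it, latest first;
   a choice is a copy index and the rank of the new node. *)
Notation path D := (seq (seq D * D)).

Definition node_rank (D : Type) (top : D) (x : path D) : D :=
  if x is c :: _ then c.2 else top.

Fixpoint descending (D : Type) (top : D) (lt : D -> D -> Prop) (x : path D) : Prop :=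
  if x is c :: x' then lt c.2 (node_rank top x') /\ descending top lt x' else True.

Fixpoint ancestor (D : Type) (x y : path D) : Prop :=
  if y is _ :: y' then x = y' \/ ancestor x y' else False.

Lemma ancestor_lt (D : Type) (top : D) (lt : D -> D -> Prop) (x y : path D) :
  (forall a b c, lt a b -> lt b c -> lt a c) ->
  descending top lt y -> ancestor x y -> lt (node_rank top y) (node_rank top x).
Proof.
move=> ltT; elim: y => [//|c y IH] /= [cy yD] [->//|xy].
by apply: ltT cy _; apply: IH.
Qed.

(* [e b] is a rank standing for the ordinal [b]; ranks above it cannot be told
   apart when [b] is the remaining length of the game. *)
Definition rank_sim (D W : Type) (below : D -> D -> Prop) (e : option W -> D)
    (b : option W) (p q : D) : Prop :=
  p = q \/ (rank_le below (e b) p /\ rank_le below (e b) q).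

Lemma rank_sim_mono (D W : Type) (wlt : W -> W -> Prop) (below : D -> D -> Prop)
    (e : option W -> D) b b' p q :
  well_founded below ->
  (forall b b', ltc wlt b' b -> rank_lt below (e b') (e b)) ->
  ltc wlt b' b -> rank_sim below e b p q -> rank_sim below e b' p q.
Proof.
move=> wf emono b'b [->|[bp bq]]; [by left|right].
by have /(rank_ltW wf) bb := emono _ _ b'b; split; apply: rank_le_trans bb _.
Qed.

(** [lt] may exceed [rank_lt] only under a [q] whose rank is at least every [e b], where the game
    cannot notice. This covers the orders of both trees. *)
Definition rank_extends (D W : Type) (below : D -> D -> Prop)
    (e : option W -> D) (lt : D -> D -> Prop) : Prop :=
  (forall p q, rank_lt below p q -> lt p q) /\
  forall b p q, ~ rank_le below (e b) q -> lt p q -> rank_lt below p q.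

Definition choice_matching (D W : Type) (below : D -> D -> Prop) (e : option W -> D)
    (lt1 lt2 : D -> D -> Prop) (b : option W) (p q : D)
    (Phi : seq D * D -> seq D * D -> Prop) : Prop :=
  (forall c d d', Phi c d -> Phi c d' -> d = d') /\
  (forall c c' d, Phi c d -> Phi c' d -> c = c') /\
  (forall c, lt1 c.2 p -> exists d, Phi c d) /\
  (forall d, lt2 d.2 q -> exists c, Phi c d) /\
  (forall c d, Phi c d -> [/\ lt1 c.2 p, lt2 d.2 q & rank_sim below e b c.2 d.2]).

(* Each choice of high rank is absorbed into the copy index of a choice of rank
   [e b'], so Cantor-Bernstein matches the high choices on both sides. *)
Lemma choices_bij (D W : Type) (wlt : W -> W -> Prop) (below : D -> D -> Prop)
    (e : option W -> D) (lt1 lt2 : D -> D -> Prop) b b' p q :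
  well_founded below ->
  (forall b b', ltc wlt b' b -> rank_lt below (e b') (e b)) ->
  rank_extends below e lt1 -> rank_extends below e lt2 ->
  ltc wlt b' b -> rank_sim below e b p q ->
  exists Phi, choice_matching below e lt1 lt2 b' p q Phi.
Proof.
move=> wf emono [sub1 low1] [sub2 low2] b'b pq.
have [[bp bq]|nhigh] := pselect (rank_le below (e b) p /\ rank_le below (e b) q); last first.
  (* Not both ranks reach [e b], so they are equal, and under such a rank [lt1] and [lt2] agree: the
     identity works. *)
  have {pq} pq : p = q by case: pq.
  subst q; have nbp : ~ rank_le below (e b) p by move=> bp; apply: nhigh.
  have lt12 s : lt1 s p <-> lt2 s p.
    by split=> [/(low1 b _ _ nbp)/sub2|/(low2 b _ _ nbp)/sub1].
  exists (fun c d => c = d /\ lt1 c.2 p); split; first by move=> c d d' [<- _] [].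
  split; first by move=> c c' d [-> _] [].
  split; first by move=> c cp; exists c.
  split; first by move=> d /lt12 dp; exists d.
  by move=> c d [<- cp]; split; [|exact/lt12|left].
have lowlt s r : rank_le below (e b) r -> ~ rank_le below (e b') s -> rank_lt below s r.
  move=> br nbs; have [//|sb'] := rank_le_total (e b') s wf.
  apply: rank_lt_le_trans br => //; apply: rank_le_lt_trans (emono _ _ b'b) => //.
  exact: rank_ltW.
have elt r : rank_le below (e b) r -> rank_lt below (e b') r.
  by move=> br; apply: rank_lt_le_trans br => //; apply: emono.
pose X (lt : D -> D -> Prop) r := ([set c : seq D * D | lt c.2 r /\ rank_le below (e b') c.2]).
pose f (c : seq D * D) : seq D * D := (c.2 :: c.1, e b').
have cardX lt lt' r r' : (forall p q, rank_lt below p q -> lt' p q) ->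
    rank_le below (e b) r' -> (X lt r #<= X lt' r')%card.
  move=> sub br'.
  have fi : {in (f @^-1` X lt' r')%classic &, injective f}.
    by move=> [k s] [k' s'] _ _ [-> ->].
  apply: card_le_trans (card_ge_preimage fi); apply: subset_card_le => c _ /=.
  by split; [apply: sub; apply: elt|apply: rank_le_refl].
have /card_bijP[g gbij] : (X lt1 p #= X lt2 q)%card.
  by apply: Cantor_Bernstein; apply: cardX.
have gi := bij_inj gbij; have [g' gg' g'g] := gbij.
(* Choices of rank less than [e b'] are available under both p and q and are matched with
   themselves; the remaining ones are matched by [g]. *)
pose Phi c d := (~ rank_le below (e b') d.2 /\ c = d) \/
  exists x, c = set_val x /\ d = set_val (g x).
have hi lt r (x : X lt r) : lt (set_val x).2 r /\ rank_le below (e b') (set_val x).2.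
  exact: (set_mem (valP x)).
exists Phi; split.
  move=> c d d' [[nc cd]|[x [-> ->]]] [[nc' cd']|[x' [xx' ->]]].
  - by rewrite -cd.
  - by case: nc; rewrite -cd xx'; have [] := hi _ _ x'.
  - by case: nc'; rewrite -cd'; have [] := hi _ _ x.
  - by move/val_inj: xx' => ->.
split.
  move=> c c' d [[nc ->]|[x [-> dx]]] [[nc' ->]|[x' [-> dx']]] //.
  - by case: nc; rewrite dx'; have [] := hi _ _ (g x').
  - by case: nc'; rewrite dx; have [] := hi _ _ (g x).
  - by move: dx'; rewrite dx => /val_inj/gi ->.
split.
  move=> c cp; have [bc|nbc] := pselect (rank_le below (e b') c.2); last by exists c; left.
  have cX : X lt1 p c by [].
  exists (set_val (g (SigSub (mem_set cX)))); right.
  by exists (SigSub (mem_set cX)).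
split.
  move=> d dq; have [bd|nbd] := pselect (rank_le below (e b') d.2); last by exists d; left.
  have dX : X lt2 q d by [].
  exists (set_val (g' (SigSub (mem_set dX)))); right.
  by exists (g' (SigSub (mem_set dX))); rewrite g'g.
move=> c d [[nbd cd]|[x [-> ->]]].
  by rewrite cd; split; [apply: sub1; apply: lowlt|apply: sub2; apply: lowlt|left].
have [? ?] := hi _ _ x; have [? ?] := hi _ _ (g x).
by split=> //; right.
Qed.

(** * Back and forth between trees *)

Record path_iso (D W : Type) (top : D) (below : D -> D -> Prop) (e : option W -> D)
    (lt1 lt2 : D -> D -> Prop) (b : option W) (n : nat)
    (F : path D -> path D -> Prop) : Prop := PathIso {
  pi_sub : forall x y, F x y -> [/\ descending top lt1 x, descending top lt2 y,
    size x = size y, size x <= n &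
    rank_sim below e b (node_rank top x) (node_rank top y)];
  pi_fun : forall x y y', F x y -> F x y' -> y = y';
  pi_inj : forall x x' y, F x y -> F x' y -> x = x';
  pi_dom : forall x, descending top lt1 x -> size x <= n -> exists y, F x y;
  pi_img : forall y, descending top lt2 y -> size y <= n -> exists x, F x y;
  pi_parent : forall c d x y, F (c :: x) (d :: y) -> F x y }.

Lemma path_iso0 (D W : Type) (top : D) (below : D -> D -> Prop) (e : option W -> D)
    (lt1 lt2 : D -> D -> Prop) (b : option W) :
  path_iso top below e lt1 lt2 b 0 (fun x y => x = [::] /\ y = [::]).
Proof.
split=> //.
- by move=> x y [-> ->]; split=> //; left.
- by move=> x y y' [_ ->] [_ ->].
- by move=> x x' y [-> _] [-> _].
- by case=> // _ _; exists [::].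
- by case=> // _ _; exists [::].
- by move=> c d x y [].
Qed.

(** Under each matched pair of length n the next choices are matched by [choices_bij]. Old pairs
    stay similar because similarity weakens as the ordinal drops. *)
Lemma path_iso_step (D W : Type) (wlt : W -> W -> Prop) (top : D)
    (below : D -> D -> Prop) (e : option W -> D) (lt1 lt2 : D -> D -> Prop)
    b b' n (F : path D -> path D -> Prop) :
  well_founded below ->
  (forall b b', ltc wlt b' b -> rank_lt below (e b') (e b)) ->
  rank_extends below e lt1 -> rank_extends below e lt2 ->
  ltc wlt b' b -> path_iso top below e lt1 lt2 b n F ->
  exists2 F', path_iso top below e lt1 lt2 b' n.+1 F' & forall x y, F x y -> F' x y.
Proof.
move=> wf emono ext1 ext2 b'b [Fs Ff Fi Fd Fr Fp].
have [Phi PhiP] : {Phi : path D * path D -> seq D * D -> seq D * D -> Prop &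
    forall xy, F xy.1 xy.2 -> choice_matching below e lt1 lt2 b'
      (node_rank top xy.1) (node_rank top xy.2) (Phi xy)}.
  apply: (@choice _ _ (fun xy Phi => F xy.1 xy.2 -> choice_matching below e lt1 lt2 b'
      (node_rank top xy.1) (node_rank top xy.2) Phi)) => -[x y] /=.
  have [Fxy|nF] := pselect (F x y); last by exists (fun _ _ => True).
  have [_ _ _ _ xy] := Fs _ _ Fxy.
  have [Phi PhiP] := choices_bij wf emono ext1 ext2 b'b xy.
  by exists Phi.
pose New x y := exists c d x0 y0,
  [/\ x = c :: x0, y = d :: y0, F x0 y0, size x0 = n & Phi (x0, y0) c d].
have FNew1 x y z : F x y -> New x z -> False.
  move=> /Fs[_ _ _ xn _] [c [d [x0 [y0 [xE _ _ x0n _]]]]].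
  by move: xn; rewrite xE /= x0n ltnn.
have FNew2 x y z : F x y -> New z y -> False.
  move=> /Fs[_ _ xy xn _] [c [d [x0 [y0 [_ yE /Fs[_ _ xy0 _ _] x0n _]]]]].
  by move: xn; rewrite xy yE /= -xy0 x0n ltnn.
exists (fun x y => F x y \/ New x y); last by left.
split.
- move=> x y [/Fs[xD yD xy xn sim]|[c [d [x0 [y0 [-> -> Fxy0 x0n Phicd]]]]]].
    by split=> //; [exact: leqW|apply: (rank_sim_mono wf emono b'b)].
  have [_ [_ [_ [_ Ps]]]] := PhiP (x0, y0) Fxy0; have [cx dy sim] := Ps _ _ Phicd.
  have [xD yD xy xn _] := Fs _ _ Fxy0.
  by split=> //=; rewrite ?xy // -xy x0n.
- move=> x y y' [Fy|Ny] [Fy'|Ny'].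
  + exact: Ff Fy Fy'.
  + by case: (FNew1 _ _ _ Fy Ny').
  + by case: (FNew1 _ _ _ Fy' Ny).
  + case: Ny Ny' => c [d [x0 [y0 [-> -> Fxy0 x0n Phicd]]]].
    move=> [c' [d' [x1 [y1 [[<- <-] -> Fxy1 _ Phicd']]]]].
    have yy := Ff _ _ _ Fxy0 Fxy1; subst y1.
    have [Pf _] := PhiP (x0, y0) Fxy0.
    by rewrite (Pf _ _ _ Phicd Phicd').
- move=> x x' y [Fy|Ny] [Fy'|Ny'].
  + exact: Fi Fy Fy'.
  + by case: (FNew2 _ _ _ Fy Ny').
  + by case: (FNew2 _ _ _ Fy' Ny).
  + case: Ny Ny' => c [d [x0 [y0 [-> -> Fxy0 x0n Phicd]]]].
    move=> [c' [d' [x1 [y1 [-> [<- <-] Fxy1 _ Phicd']]]]].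
    have xx := Fi _ _ _ Fxy0 Fxy1; subst x1.
    have [_ [Pi _]] := PhiP (x0, y0) Fxy0.
    by rewrite (Pi _ _ _ Phicd Phicd').
- move=> x xD; rewrite leq_eqVlt ltnS => /orP[/eqP xn|xn]; last first.
    by have [y Fxy] := Fd _ xD xn; exists y; left.
  case: x xD xn => [//|c x0] /= [cx xD] [xn].
  have [|y0 Fxy0] := Fd _ xD _; first by rewrite xn.
  have [_ [_ [Pd _]]] := PhiP (x0, y0) Fxy0; have [d Phicd] := Pd c cx.
  by exists (d :: y0); right; exists c, d, x0, y0.
- move=> y yD; rewrite leq_eqVlt ltnS => /orP[/eqP yn|yn]; last first.
    by have [x Fxy] := Fr _ yD yn; exists x; left.
  case: y yD yn => [//|d y0] /= [dy yD] [yn].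
  have [|x0 Fxy0] := Fr _ yD _; first by rewrite yn.
  have [_ [_ [_ [Pr _]]]] := PhiP (x0, y0) Fxy0; have [c Phicd] := Pr d dy.
  exists (c :: x0); right; exists c, d, x0, y0; split=> //.
  by have [_ _ -> _ _] := Fs _ _ Fxy0.
- by move=> c d x y [/Fp|[c' [d' [x0 [y0 [[_ ->] [_ ->] ? _ _]]]]]]; left.
Qed.

Lemma path_iso_ancestor (D W : Type) (top : D) (below : D -> D -> Prop)
    (e : option W -> D) (lt1 lt2 : D -> D -> Prop) b n F x y x' y' :
  path_iso top below e lt1 lt2 b n F -> F x y -> F x' y' ->
  ancestor x x' <-> ancestor y y'.
Proof.
move=> [Fs Ff Fi Fd Fr Fp] Fxy; elim: x' y' => [|c x' IH] [|d y'] // Fxy'.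
- by have [_ _ ] := Fs _ _ Fxy'.
- by have [_ _ ] := Fs _ _ Fxy'.
have /= IHy := IH _ (Fp _ _ _ _ Fxy'); split=> -[xx'|/IHy]; try by right.
  by left; subst x'; apply: Ff Fxy (Fp _ _ _ _ Fxy').
by left; subst y'; apply: Fi Fxy (Fp _ _ _ _ Fxy').
Qed.

Lemma preserves_qf_relational (t : vocab) (M1 M2 : model t)
    (g : carrier M1 -> carrier M2 -> Prop) :
  (Fsym t -> False) ->
  (forall a b b', g a b -> g a b' -> b = b') ->
  (forall a a' b, g a b -> g a' b -> a = a') ->
  (forall r v w, (forall i, g (v i) (w i)) -> Defs.rel M1 r v <-> Defs.rel M2 r w) ->
  preserves_qf g.
Proof.
move=> nF gf gi gR k phi v w gvw.
have gt (u : term t k) : g (eval M1 v u) (eval M2 w u).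
  by case: u => [i|f args]; [exact: gvw|case: (nF f)].
have ga (a : atomic t k) : holds_atomic M1 a v <-> holds_atomic M2 a w.
  case: a => [r args|u1 u2] /=; first by apply: gR => i; apply: gt.
  by split=> E; [apply: gf (gt u1) _|apply: gi (gt u1) _]; rewrite E; apply: gt.
by case: phi => a /=; rewrite ga.
Qed.

Definition tree_vocab : vocab := Vocab (fun _ : nat => 2) (fun _ : void => 0).

(* In the [n]-th model only the [n]-th relation is proper: in the product it
   then compares the [n]-th coordinates alone. *)
Definition tree_model (D : Type) (top : D) (lt : D -> D -> Prop) (n : nat) :
    model tree_vocab :=
  @Model tree_vocab {x : path D | descending top lt x}
    (fun r xs => r = n ->
      ancestor (sval (xs (ord0 : 'I_2))) (sval (xs (ord_max : 'I_2))))
    (fun f => match f with end).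

(** Applies [level_E0] with the length of a node as its level and the relations of [path_iso] as the
    family; [hat] moves them to the subtypes of descending paths. *)
Lemma tree_model_E0 (D W Theta : Type) (wlt : W -> W -> Prop) (top : D)
    (below : D -> D -> Prop) (e : option W -> D) (lt1 lt2 : D -> D -> Prop)
    (n : nat) pR pF :
  card_le (Theta + Theta) Theta -> well_founded wlt -> well_founded below ->
  (forall b b', ltc wlt b' b -> rank_lt below (e b') (e b)) ->
  rank_extends below e lt1 -> rank_extends below e lt2 ->
  E0 Theta wlt (reduct pR pF (tree_model top lt1 n)) (reduct pR pF (tree_model top lt2 n)).
Proof.
move=> cTT wfW wf emono ext1 ext2.
pose hat (F : path D -> path D -> Prop) :=
  fun (a : carrier (tree_model top lt1 n)) (b : carrier (tree_model top lt2 n)) =>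
    F (sval a) (sval b).
apply: (@level_E0 _ _ _ _ (reduct pR pF (tree_model top lt1 n))
    (reduct pR pF (tree_model top lt2 n)) (fun a => size (sval a)) (fun a => size (sval a))
    (fun b m G => exists2 F, path_iso top below e lt1 lt2 b m F & G = hat F)) => //.
- move=> b m _ [F isoF ->]; have [Fs Ff Fi Fd Fr Fp] := isoF.
  have hf a c c' : hat F a c -> hat F a c' -> c = c'.
    move=> Fc Fc'; have := Ff _ _ _ Fc Fc'.
    by case: c c' {Fc Fc'} => [c ?] [c' ?] /= ?; apply: eq_exist.
  have hi a a' c : hat F a c -> hat F a' c -> a = a'.
    move=> Fc Fc'; have := Fi _ _ _ Fc Fc'.
    by case: a a' {Fc Fc'} => [c1 ?] [c2 ?] /= ?; apply: eq_exist.
  split=> //.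
  + move=> [x xD] /= xm; have [y Fxy] := Fd _ xD xm; have [_ yD _ _ _] := Fs _ _ Fxy.
    by exists (exist _ y yD).
  + move=> [y yD] /= ym; have [x Fxy] := Fr _ yD ym; have [xD _ _ _ _] := Fs _ _ Fxy.
    by exists (exist _ x xD).
  + by move=> a c /Fs[].
  + apply: preserves_qf_relational => //; first by case=> -[].
    move=> [r rR] v w gvw /=.
    have anc := path_iso_ancestor isoF (gvw (ord0 : 'I_2)) (gvw (ord_max : 'I_2)).
    by split=> H rn; apply/anc; apply: H.
- move=> b m _ b' [F isoF ->] b'b.
  have [F' isoF' FF'] := path_iso_step wf emono ext1 ext2 b'b isoF.
  by exists (hat F'); [exists F'|move=> x y; apply: FF'].
- by exists (hat (fun x y => x = [::] /\ y = [::])), (fun x y => x = [::] /\ y = [::]);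
    first exact: path_iso0.
Qed.

(** * The models *)

(** Points of well-founded relations on [Theta] serve as notations for the ordinals below the
    cardinal successor of [Theta]. *)
Record wf_point (Theta : Type) := WfPoint {
  wp_rel : Theta -> Theta -> Prop;
  wp_wf : well_founded wp_rel;
  wp_pt : Theta }.

(* [None] lies above all well-founded relations on [Theta]. *)
Definition wp_below (Theta : Type) (p q : option (wf_point Theta)) : Prop :=
  match p, q with
  | Some a, Some b => wp_rel a = wp_rel b /\ wp_rel b (wp_pt a) (wp_pt b)
  | Some _, None => True
  | None, _ => False
  end.

Lemma wp_below_wf (Theta : Type) : well_founded (@wp_below Theta).
Proof.
have wfS (b : wf_point Theta) : Acc (@wp_below Theta) (Some b).
  suff H (r : Theta -> Theta -> Prop) x : well_founded r -> forall a, wp_rel a = r ->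
      wp_pt a = x -> Acc (@wp_below Theta) (Some a).
    exact: (H _ _ (wp_wf b)).
  move=> wf; elim: (wf x) => {}x _ IH a ar ax.
  apply: Acc_intro => -[a' [a'a lt_a]|[]].
  by apply: (IH (wp_pt a') _ a') => //; rewrite -?ar -?ax ?a'a.
by case=> [b|]; [exact: wfS|apply: Acc_intro => -[b _|[]]; exact: wfS].
Qed.

(** The well order is copied along the injection to one relation on [Theta]; its elements become
    points of that relation. *)
Lemma wp_embedding (Theta : Type) (alpha : WO) : card_le (wo_W alpha) Theta ->
  exists e : option (wo_W alpha) -> option (wf_point Theta),
    e None = None /\
    forall b b', ltc (@wo_lt alpha) b' b -> rank_lt (@wp_below Theta) (e b') (e b).
Proof.
move=> [f fi].
pose r (x y : Theta) := exists u v, [/\ f u = x, f v = y & wo_lt u v].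
have wf : well_founded r.
  have wfr u : Acc r (f u).
    elim: (wo_wf u) => {}u _ IH; apply: Acc_intro => _ [u' [v' [<- /fi -> u'v']]].
    exact: IH.
  by move=> x; apply: Acc_intro => _ [u [v [<- _ _]]]; exact: wfr.
exists (fun b => if b is Some u then Some (WfPoint wf (f u)) else None); split=> //.
move=> [v|] [u|] //= uv; exists (Some (WfPoint wf (f u))) => //=;
  try exact/rank_le_refl/wp_below_wf.
by split=> //; exists u, v.
Qed.

Definition rank_lt_inf (Theta : Type) (p q : option (wf_point Theta)) : Prop :=
  rank_lt (@wp_below Theta) p q \/ (p = None /\ q = None).

(** The extra pair lies under [None], which is [e None] and so has rank at least every [e b]. *)
Lemma rank_lt_inf_extends (Theta W : Type) (wlt : W -> W -> Prop)
    (e : option W -> option (wf_point Theta)) :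
  e None = None -> (forall b b', ltc wlt b' b -> rank_lt (@wp_below Theta) (e b') (e b)) ->
  rank_extends (@wp_below Theta) e (@rank_lt_inf Theta).
Proof.
move=> eN emono; split; first by move=> p q; left.
move=> b p q nbq [//|[_ qN]]; case: nbq; rewrite qN -eN.
case: b => [w|]; last exact/rank_le_refl/wp_below_wf.
by apply: (rank_ltW (@wp_below_wf Theta)); apply: emono.
Qed.

(** * Robust chains in the products *)

Lemma seq_nat_card_le_continuum : card_le (nat -> nat) continuum.
Proof.
exists (fun f m => if unpickle m is Some (i, j) then f i == j else false) => f g fg.
apply: functional_extensionality_dep => i.
by have := congr1 (@^~ (pickle (i, f i))) fg; rewrite /= pickleK eqxx => /esym/eqP.
Qed.

Definition branch_node (Theta : Type) (i : nat) : path (option (wf_point Theta)) :=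
  nseq i ([::], None).

Lemma branch_node_descending (Theta : Type) (i : nat) :
  descending None (@rank_lt_inf Theta) (branch_node Theta i).
Proof. by elim: i => // i IH; split=> //; case: i {IH} => [|i]; right. Qed.

Lemma branch_node_ancestor (Theta : Type) (i j : nat) :
  i < j -> ancestor (branch_node Theta i) (branch_node Theta j).
Proof.
by elim: j => // j IH; rewrite ltnS leq_eqVlt => /orP[/eqP ->|/IH]; [left|right].
Qed.

Lemma robust_chain_prod_inf (Theta : Type) :
  robust_chain continuum (prod_model (tree_model None (@rank_lt_inf Theta))).
Proof.
pose br (f : nat -> nat) : carrier (prod_model (tree_model None (@rank_lt_inf Theta))) :=
  fun n => exist _ (branch_node Theta (f n)) (branch_node_descending Theta (f n)).
exists (fun a => exists f, a = br f); split.
  apply: (@card_le_trans_type _ (nat -> nat)); last exact: seq_nat_card_le_continuum.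
  have [c cE] : {c : {a | exists f, a = br f} -> nat -> nat & forall a, sval a = br (c a)}.
    apply: (@choice _ _ (fun a f => sval a = br f)) => -[a [f af]].
    by exists f.
  exists c => a b ab; have := cE b; rewrite -ab -cE.
  by case: a b {ab} => [a ?] [b ?] /= ba; apply: eq_exist.
move=> h.
(* Otherwise each piece [h = n] omits a value [g n] in coordinate n; but [br g] lies in some piece
   and takes the omitted value there. *)
have [n nP] : exists n, forall i, exists f, h (br f) = n /\ f n = i.
  apply: contrapT => H.
  have [g gP] : {g : nat -> nat & forall n f, h (br f) = n -> f n <> g n}.
    apply: (@choice _ _ (fun n i => forall f, h (br f) = n -> f n <> i)) => n.
    apply: contrapT => Hn; apply: H; exists n => i; apply: contrapT => Hi.
    by apply: Hn; exists i => f hf fi; apply: Hi; exists f.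
  exact: (gP _ g erefl).
have [f fP] := choice nP.
exists n, n, (fun i => br (f i)); split=> [i|i j ij].
  by split; [exists (f i)|have [] := fP i].
move=> l /= nl; rewrite -nl.
have [_ ->] := fP i; have [_ ->] := fP j.
exact: branch_node_ancestor.
Qed.

Lemma wf_no_seq (D : Type) (R : D -> D -> Prop) (x : nat -> D) :
  well_founded R -> ~ forall i, R (x i.+1) (x i).
Proof.
move=> wf H; suff no d : Acc R d -> forall i, x i <> d by exact: (no _ (wf (x 0)) 0).
by elim=> {}d _ IH i xi; apply: (IH (x i.+1)) (erefl _); rewrite -xi.
Qed.

(** Even the partition into one piece fails: a chain for the relation r is an ancestor chain in
    coordinate r, hence an infinite descent of ranks. *)
Lemma not_robust_chain_prod_wf (Theta Theta' : Type) :
  ~ robust_chain Theta' (prod_model (tree_model None (rank_lt (@wp_below Theta)))).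
Proof.
move=> [A [_ robA]]; have [r [_ [x [_ xr]]]] := robA (fun _ => 0).
have wf := @wp_below_wf Theta.
apply: (@wf_no_seq _ _ (fun i => node_rank None (sval (x i r))) (rank_lt_wf wf)) => i.
apply: ancestor_lt (proj2_sig (x i.+1 r)) (xr i i.+1 (leqnn _) r erefl).
by move=> a b c ab bc; apply: rank_le_lt_trans bc => //; apply: rank_ltW.
Qed.

Lemma robust_chain_reduct (Theta : Type) (t : vocab) (M : model t) :
  robust_chain Theta (reduct (fun _ => True) (fun _ => True) M) <->
  robust_chain Theta M.
Proof.
split=> -[A [cA robA]]; exists A; split=> // h; have [r [m [x xP]]] := robA h.
  by exists (sval r), m, x.
by exists (exist _ r I), m, x.
Qed.

(** ISO wins the game of every length a sentence can use, so the two reducts share an [E1]-class,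
    and this class decides the sentence. *)
Lemma L1_equiv_tree_model (Theta : Type) (n : nat) : card_le nat Theta ->
  L1_equiv Theta (tree_model None (@rank_lt_inf Theta) n)
    (tree_model None (rank_lt (@wp_below Theta)) n).
Proof.
move=> /sum_card_le cTT psi.
have [e [eN emono]] := wp_embedding (s_alpha_card psi).
have MN : E1 Theta (s_alpha psi)
    (reduct (s_pR psi) (s_pF psi) (tree_model None (@rank_lt_inf Theta) n))
    (reduct (s_pR psi) (s_pF psi) (tree_model None (rank_lt (@wp_below Theta)) n)).
  apply: rst_step; apply: (tree_model_E0 None n (s_pR psi) (s_pF psi) cTT (@wo_wf _)
    (@wp_below_wf Theta) emono).
  - exact: rank_lt_inf_extends eN emono.
  - by split=> // b p q _.
split=> [[i Mi]|[i Mi]]; exists i.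
  exact: rst_trans (rst_sym _ _ _ _ MN) Mi.
exact: rst_trans MN Mi.
Qed.

Theorem theorem4p10 :
  forall Theta : Type, card_le nat Theta ->
  exists (t : vocab) (Ms Ns : nat -> model t),
    countable_vocab t /\
    (forall n, L1_equiv Theta (Ms n) (Ns n)) /\
    ~ L1_equiv continuum (prod_model Ms) (prod_model Ns) /\
    AIS_wins continuum omega1_lt (prod_model Ms) (prod_model Ns).
Proof.
move=> Theta cT.
exists tree_vocab, (tree_model None (@rank_lt_inf Theta)),
  (tree_model None (rank_lt (@wp_below Theta))).
have rM := @robust_chain_prod_inf Theta.
have nrN := @not_robust_chain_prod_wf Theta continuum.
split; first by split; [exists id|exists (fun f : void => 0); case].
split; first by move=> n; apply: L1_equiv_tree_model.
split; last by right; apply: robust_chain_aiswin.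
move=> equiv.
have nat_cont : card_le nat continuum.
  by exists (fun n m => n == m) => n m /(congr1 (@^~ n)); rewrite /= eqxx => /esym/eqP.
have cRF : card_le ({r : Rsym tree_vocab | True} + {f : Fsym tree_vocab | True}) continuum.
  have [f fi] := nat_cont.
  exists (fun x => match x with
    | inl r => f (sval r) | inr g => match sval g : void with end end).
  by move=> [[r []]|[[]]] [[r' []]|[[]]] /fi /= ->.
have calpha : card_le (wo_W omega1) continuum.
  by apply: card_le_trans_type nat_cont; exists pickle; apply: (pcan_inj pickleK).
have cI : card_le unit (beth_succ omega1 continuum).
  by exists (fun _ _ => True) => -[] [].
(* With the full vocabulary, the ordinal omega + 1 and the first product as its only model, [psi]
   defines the [E1]-class of that product. *)
pose psi := L1Sent cRF calpha cI
  (fun _ => reduct (fun _ => True) (fun _ => True)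
    (prod_model (tree_model None (@rank_lt_inf Theta)))).
have sM : sat1 (prod_model (tree_model None (@rank_lt_inf Theta))) psi.
  by exists tt; exact: rst_refl.
have [/(_ sM)[u NM] _] := equiv psi.
by apply: nrN; apply/robust_chain_reduct/(robust_chain_E1 NM)/robust_chain_reduct.
Qed.
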